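(* Consider the test-time alignment setting and the algorithm VGB described in the context. Fix any prompt $x\in\mathcal X$ and $\delta>0$, and suppose that for each $h\in[H]$, $$\mathbb E_{y_{1:h}\sim\pi^\star(\cdot\mid x)}\left[\frac{\hat V(x,y_{1:h})}{V^\star(x,y_{1:h})}\right]\le1+\varepsilon_V,\qquad \mathbb E_{y_{1:h}\sim\pi^\star(\cdot\mid x)}\left[\frac{V^\star(x,y_{1:h})}{\hat V(x,y_{1:h})}\right]\le1+\varepsilon_V .$$ Then the runtime of VGB with step count $T:=\tilde O\big(H^5\cdot(1+\varepsilon_V)^6\cdot\delta^{-4}\big)$, run on prompt $x$ and returning $y^{(i)}$ for a uniformly random index $i\in\{1,\dots,T\}$, is $O(T\cdot|\mathcal A|)$, and its output distribution $\hat\pi$ (over nodes of $\mathcal T$) satisfies $$\Pr_{y_{1:H}\sim\pi^\star(\cdot\mid x)}\left[\frac{\pi^\star(y_{1:H}\mid x)}{\hat\pi(y_{1:H})}>\frac{48H(1+\varepsilon_V)^2}{\delta}\right]\le\delta .$$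
   Context: Setting. $\mathcal A$ is a finite action set, $H\ge1$ an integer, $\mathcal X$ a prompt set, $\mathcal Y=\mathcal A^H$. The base model $\pi_{\mathrm{ref}}$ assigns to each $x\in\mathcal X$ a probability distribution $\pi_{\mathrm{ref}}(\cdot\mid x)$ on $\mathcal Y$; $\pi_{\mathrm{ref}}(y_h\mid x,y_{1:h-1})$ is the next-action conditional probability. The tilt function is $\tau:\mathcal X\times\mathcal Y\to\mathbb R_{\ge0}$, and the true value function is $V^\star(x,y_{1:h})=\mathbb E_{y_{1:H}\sim\pi_{\mathrm{ref}}(\cdot\mid x)}[\tau(x,y_{1:H})\mid y_{1:h}]$. The target is $\pi^\star(y\mid x)\propto\pi_{\mathrm{ref}}(y\mid x)\tau(x,y)$ (the normalizing constant $\mathbb E_{\pi_{\mathrm{ref}}(\cdot\mid x)}[\tau(x,y)]$ is positive); $y_{1:h}\sim\pi^\star(\cdot\mid x)$ means the length-$h$ prefix of a sample from $\pi^\star(\cdot\mid x)$. An approximate value function gives a value $\hat V(x,y_{1:h})\ge0$ to each prompt and each prefix (leaves $h=H$ included; $\tau$ need not be known); $\varepsilon_V\ge0$ is a parameter. Tree. $\mathcal T$ is the rooted tree with node set $\bigcup_{h=0}^H\mathcal A^h$, root $\varnothing$, in which $y_{1:h-1}$ is the parent of $y_{1:h}$; leaves are the elements of $\mathcal A^H$. $\hat\pi(y_{1:H})$ is the probability that the output equals the leaf $y_{1:H}$. VGB. Start at $y^{(0)}=\varnothing$. For $t=0,\dots,T-1$: let $h=|y^{(t)}|$, and let $p^{(t)}$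 be the probability distribution on the neighbours of $y^{(t)}=y^{(t)}_{1:h}$ in $\mathcal T$ with weights: parent $y^{(t)}_{1:h-1}$ (if $h>0$) gets weight $\hat V(x,y^{(t)}_{1:h})$; child $(y^{(t)}_{1:h},a)$, $a\in\mathcal A$ (if $h<H$), gets weight $\pi_{\mathrm{ref}}(a\mid x,y^{(t)}_{1:h})\hat V(x,(y^{(t)}_{1:h},a))$. With probability $1/2$ set $y^{(t+1)}=y^{(t)}$; otherwise draw $y^{(t+1)}\sim p^{(t)}$ ($p^{(t)}$ is computed explicitly by enumerating $\mathcal A$). Runtime counts evaluations of $\hat V$ and queries to $\pi_{\mathrm{ref}}$. $\tilde O(\cdot)$ hides constants and logarithmic factors.
   Formalization: The formal theorem additionally assumes that V̂(x,y_{1:h}) = 0 for each prefix (1 ≤ h ≤ H) with positive π_ref-probability and V*(x,y_{1:h}) = 0; without this the claim fails, as the accuracy bounds do not constrain V̂ there. *)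

(* Defs.v *)
From mathcomp Require Import all_boot all_order all_algebra.
From mathcomp Require Import all_classical all_reals all_analysis.

Set Implicit Arguments.
Unset Strict Implicit.
Unset Printing Implicit Defensive.

Import Order.TTheory GRing.Theory Num.Theory.

Local Open Scope ring_scope.

(* Prompts are the points of an arbitrary type X and full responses are the
   H-tuples over A.  A node y_{1:h} of the tree is the sequence s : seq A of its
   h actions; only sequences of size at most H are nodes, so functions on nodes
   are taken on seq A and never consulted on longer sequences. *)

Definition is_distr (R : realType) (I : finType) (p : I -> R) : Prop :=
  (forall i, 0 <= p i) /\ \sum_i p i = 1.

(* The values of f are extended so that a quotient with denominator 0 is not
   silently 0: on \bar R, a%:E / 0%:E = +oo for a > 0, and 0%:E / 0%:E = 0. *)
Definition expect (R : realType) (I : finType) (p : I -> R) (f : I -> \bar R) :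
  \bar R := (\sum_i (p i)%:E * f i)%E.

Definition prob_of (R : realType) (I : finType) (p : I -> R) (E : pred I) : R :=
  \sum_(i | E i) p i.


Definition prefix_prob (R : realType) (A : finType) (H : nat)
  (p : H.-tuple A -> R) (s : seq A) : R :=
  \sum_(y : H.-tuple A | take (size s) y == s) p y.

Definition next_prob (R : realType) (A : finType) (H : nat)
  (p : H.-tuple A -> R) (s : seq A) (a : A) : R :=
  prefix_prob p (rcons s a) / prefix_prob p s.

(* The conditional expectation E_{y ~ p}[t y | y_{1:h} = s] for h = size s. *)
Definition cond_expect (R : realType) (A : finType) (H : nat)
  (p t : H.-tuple A -> R) (s : seq A) : R :=
  (\sum_(y : H.-tuple A | take (size s) y == s) p y * t y) / prefix_prob p s.

Definition normalizer (R : realType) (A : finType) (H : nat)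
  (p t : H.-tuple A -> R) : R := \sum_(y : H.-tuple A) p y * t y.

Definition tilt (R : realType) (A : finType) (H : nat)
  (p t : H.-tuple A -> R) (y : H.-tuple A) : R :=
  p y * t y / normalizer p t.


(* Randomized programs with oracle access to the value function and to the
   next-action probabilities of the base model.  [Draw ws k] continues with
   [k i] with probability ws`_i / \sum_j ws`_j, for i < size ws. *)
Inductive prog (R X A B : Type) : Type :=
| Ret of B
| AskV of X & seq A & (R -> prog R X A B)
| AskRef of X & seq A & A & (R -> prog R X A B)
| Draw of seq R & (nat -> prog R X A B).

Arguments Ret {R X A B} b.
Arguments AskV {R X A B} x s k.
Arguments AskRef {R X A B} x s a k.
Arguments Draw {R X A B} ws k.

Fixpoint bind (R X A B C : Type) (m : prog R X A B) (f : B -> prog R X A C) :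
  prog R X A C :=
  match m with
  | Ret b => f b
  | AskV x s k => AskV x s (fun r => bind (k r) f)
  | AskRef x s a k => AskRef x s a (fun r => bind (k r) f)
  | Draw ws k => Draw ws (fun i => bind (k i) f)
  end.

Notation "x <~ m ;; k" := (bind m (fun x => k))
  (at level 100, m at next level, right associativity).

Definition ask_V (R X A : Type) (x : X) (s : seq A) : prog R X A R :=
  AskV x s Ret.

Definition ask_ref (R X A : Type) (x : X) (s : seq A) (a : A) : prog R X A R :=
  AskRef x s a Ret.

(* Draws c with probability proportional to w over the entries (c, w) of l;
   c0 is only a default for indexing. *)
Definition draw_from (R X A C : Type) (c0 : C) (l : seq (C * R)) :
  prog R X A C :=
  Draw (unzip2 l) (fun i => Ret (nth c0 (unzip1 l) i)).

(* The probability that m, run with the oracles V and q, returns b. *)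
Fixpoint out_prob (R : realType) (X A : Type) (B : eqType)
  (V : X -> seq A -> R) (q : X -> seq A -> A -> R) (m : prog R X A B) (b : B) :
  R :=
  match m with
  | Ret c => (c == b)%:R
  | AskV x s k => out_prob V q (k (V x s)) b
  | AskRef x s a k => out_prob V q (k (q x s a)) b
  | Draw ws k => \sum_(i < size ws)
      ws`_i / (\sum_(j < size ws) ws`_j) * out_prob V q (k i) b
  end.

(* The number of oracle queries made by m, maximized over all random draws. *)
Fixpoint runtime (R : realType) (X A B : Type)
  (V : X -> seq A -> R) (q : X -> seq A -> A -> R) (m : prog R X A B) : nat :=
  match m with
  | Ret _ => 0%N
  | AskV x s k => (runtime V q (k (V x s))).+1
  | AskRef x s a k => (runtime V q (k (q x s a))).+1
  | Draw ws k => \max_(i < size ws) runtime V q (k i)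
  end.

Fixpoint weigh_children (R : realType) (X : Type) (A : finType)
  (x : X) (y : seq A) (actions : seq A) : prog R X A (seq (seq A * R)) :=
  if actions is a :: actions' then
    q <~ ask_ref R x y a ;;
    v <~ ask_V R x (rcons y a) ;;
    l <~ weigh_children R x y actions' ;;
    Ret ((rcons y a, q * v) :: l)
  else Ret [::].

Definition weigh_parent (R : realType) (X : Type) (A : finType)
  (x : X) (y : seq A) : prog R X A (seq (seq A * R)) :=
  if (0 < size y)%N then
    v <~ ask_V R x y ;; Ret [:: (take (size y).-1 y, v)]
  else Ret [::].

(* All weights may vanish only at a node that is reached with probability 0
   under the accuracy bounds on the value function; there the draw has no
   outcome (division by 0 is 0). *)
Definition vgb_step (R : realType) (X : Type) (A : finType) (H : nat)
  (x : X) (y : seq A) : prog R X A (seq A) :=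
  up <~ weigh_parent R x y ;;
  down <~ (if (size y < H)%N then weigh_children R x y (enum A)
           else Ret [::]) ;;
  stay <~ draw_from X A true [:: (true, 2^-1 : R); (false, 2^-1 : R)] ;;
  if stay then Ret y else draw_from X A y (up ++ down).

(* The trajectory y^(1), ..., y^(T) of the walk from y^(0) = y. *)
Fixpoint vgb_walk (R : realType) (X : Type) (A : finType) (H : nat)
  (x : X) (T : nat) (y : seq A) : prog R X A (seq (seq A)) :=
  if T is T'.+1 then
    y' <~ vgb_step R H x y ;;
    l <~ vgb_walk R H x T' y' ;;
    Ret (y' :: l)
  else Ret [::].

Definition vgb (R : realType) (X : Type) (A : finType) (H : nat)
  (x : X) (T : nat) : prog R X A (seq A) :=
  l <~ vgb_walk R H x T [::] ;;
  draw_from X A [::] [seq (y, 1 : R) | y <- l].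

(* The members of the class of soft-O of f: f times a constant C and a power k
   of log f, rounded up to an integer; 2 + f keeps the logarithm positive. *)
Definition softO (R : realType) (C : R) (k : nat) (f : R) : nat :=
  `| Num.ceil (C * f * ln (2 + f) ^+ k) |%N.

(* Main.v *)
(* The walk is reversible: the edge from a node s to its parent has weight
   c(s) = piref(s) Vhat(s), and a node has weight w(s), the sum of the weights of
   its edges.  So the time spent at a leaf y by a walk from the root is
   w(y) / w(root) times the time spent at the root by a walk from y, and the
   latter is governed by the mean time eta(y) in which a walk climbs from y to
   the root.  On a tree eta is explicit: climbing one edge from s takes time
   2 M(s) / c(s), where M(s) is the total weight of the subtree of s, and
   Poisson's equation for eta gives, without any mixing-time estimate,
   [visits to y in T steps] >= w(y) (T + 1 - eta(y)) / M(root).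
   With r = Vhat / Vstar, c is proportional to pistar(s) r(s), so the accuracy
   bounds give M(root) = O(H (1 + epsV)), and Markov's inequality, applied to
   1 / r at the leaf and to the sums over the levels of 1 / r and of the
   conditional subtree weights, gives eta(y) = O(H^3 (1 + epsV)^2 / delta^2)
   outside an event of probability delta.  The exponents allowed for T
   therefore leave room to spare, and no logarithm is needed. *)

Require Import Defs.
From mathcomp Require Import all_boot all_order all_algebra.
From mathcomp Require Import all_classical all_reals all_analysis.
From mathcomp Require Import zify ring lra.

Set Implicit Arguments.
Unset Strict Implicit.
Unset Printing Implicit Defensive.

Import Order.TTheory GRing.Theory Num.Theory.

Local Open Scope ring_scope.

(** * Mean values and query counts of randomized programs *)

(** A [Draw] of total weight 0 has mean 0, so this integrates against a sub-probability: the mean of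
    the constant 1 can be smaller than 1. *)
Fixpoint prog_mean (R : realType) (X A B : Type) (V : X -> seq A -> R)
  (q : X -> seq A -> A -> R) (m : prog R X A B) (F : B -> R) : R :=
  match m with
  | Ret b => F b
  | AskV x s k => prog_mean V q (k (V x s)) F
  | AskRef x s a k => prog_mean V q (k (q x s a)) F
  | Draw ws k => \sum_(i < size ws)
      ws`_i / (\sum_(j < size ws) ws`_j) * prog_mean V q (k i) F
  end.

Section Programs.
Variables (R : realType) (X A : Type).
Variables (V : X -> seq A -> R) (q : X -> seq A -> A -> R).

Lemma out_prob_mean (B : eqType) (m : prog R X A B) b :
  out_prob V q m b = prog_mean V q m (fun c => (c == b)%:R).
Proof.
elim: m => [c|x s k IH|x s a k IH|ws k IH] //=.
by apply: eq_bigr => i _; rewrite IH.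
Qed.

Lemma eq_prog_mean (B : Type) (m : prog R X A B) F G :
  F =1 G -> prog_mean V q m F = prog_mean V q m G.
Proof.
move=> FG; elim: m => [c|x s k IH|x s a k IH|ws k IH] //=.
by apply: eq_bigr => i _; rewrite IH.
Qed.

Lemma prog_mean_bind (B D : Type) (m : prog R X A B) (f : B -> prog R X A D) F :
  prog_mean V q (bind m f) F
  = prog_mean V q m (fun b => prog_mean V q (f b) F).
Proof.
elim: m => [c|x s k IH|x s a k IH|ws k IH] //=.
by apply: eq_bigr => i _; rewrite IH.
Qed.

Lemma prog_meanD (B : Type) (m : prog R X A B) F G :
  prog_mean V q m (fun b => F b + G b) = prog_mean V q m F + prog_mean V q m G.
Proof.
elim: m => [c|x s k IH|x s a k IH|ws k IH] //=.
by rewrite -big_split; apply: eq_bigr => i _; rewrite IH mulrDr.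
Qed.

Lemma prog_meanZ (B : Type) (m : prog R X A B) (a : R) F :
  prog_mean V q m (fun b => a * F b) = a * prog_mean V q m F.
Proof.
elim: m => [c|x s k IH|x s b k IH|ws k IH] //=.
by rewrite big_distrr; apply: eq_bigr => i _ /=; rewrite IH mulrCA.
Qed.

Lemma prog_mean_draw_from (D : Type) (c0 : D) l F :
  prog_mean V q (draw_from X A c0 l) F
  = (\sum_(z <- l) z.2 * F z.1) / \sum_(z <- l) z.2.
Proof.
rewrite /= !size_map.
have -> : \sum_(j < size l) (unzip2 l)`_j = \sum_(z <- l) z.2.
  rewrite (big_nth (c0, 0)) big_mkord; apply: eq_bigr => i _.
  by rewrite (nth_map (c0, 0)).
rewrite [\sum_(z <- l) _ * _](big_nth (c0, 0)) big_mkord mulr_suml.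
apply: eq_bigr => i _.
by rewrite !(nth_map (c0, 0)) // mulrAC.
Qed.

Lemma runtime_bind (B D : Type) (m : prog R X A B) (f : B -> prog R X A D)
  (n : nat) : (forall b, (runtime V q (f b) <= n)%N) ->
  (runtime V q (bind m f) <= runtime V q m + n)%N.
Proof.
move=> fn; elim: m => [c|x s k IH|x s b k IH|ws k IH] /=.
- exact: fn.
- by rewrite addSn ltnS.
- by rewrite addSn ltnS.
- apply/bigmax_leqP => i _; apply: leq_trans (IH _) _.
  by rewrite leq_add2r (leq_bigmax i).
Qed.

Lemma runtime_draw_from (D : Type) (c0 : D) l :
  runtime V q (draw_from X A c0 l) = 0%N.
Proof. by apply/eqP; rewrite -leqn0; apply/bigmax_leqP. Qed.

End Programs.

(** * The transition operator of the walk, its visit counts and its cost *)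

Section Walk.
Variables (R : realType) (X : Type) (A : finType) (H : nat).
Variables (V : X -> seq A -> R) (q : X -> seq A -> A -> R) (x : X).

Definition up_moves (s : seq A) : seq (seq A * R) :=
  if (0 < size s)%N then [:: (take (size s).-1 s, V x s)] else [::].

Definition down_moves (s : seq A) : seq (seq A * R) :=
  if (size s < H)%N
  then [seq (rcons s a, q x s a * V x (rcons s a)) | a <- enum A] else [::].

Definition moves s := up_moves s ++ down_moves s.

(** The lazy transition operator acting on functions. Where all weights vanish the quotient is 0 and
    only the lazy half of the mass survives. *)
Definition step_mean (F : seq A -> R) (s : seq A) : R :=
  2^-1 * F s
  + 2^-1 * ((\sum_(z <- moves s) z.2 * F z.1) / \sum_(z <- moves s) z.2).

Lemma prog_mean_weigh_children s acts F :
  prog_mean V q (weigh_children R x s acts) F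
  = F [seq (rcons s a, q x s a * V x (rcons s a)) | a <- acts].
Proof.
elim: acts F => [|a acts IH] F //=.
by rewrite prog_mean_bind IH.
Qed.

Lemma prog_mean_vgb_step s F :
  prog_mean V q (vgb_step R H x s) F = step_mean F s.
Proof.
rewrite /vgb_step prog_mean_bind.
have -> G : prog_mean V q (weigh_parent R x s) G = G (up_moves s).
  by rewrite /weigh_parent /up_moves; case: ifP.
rewrite prog_mean_bind.
have -> G : prog_mean V q (if (size s < H)%N then weigh_children R x s (enum A)
                           else Ret [::]) G = G (down_moves s).
  by rewrite /down_moves; case: ifP => // _; rewrite prog_mean_weigh_children.
rewrite prog_mean_bind prog_mean_draw_from !big_cons !big_nil /=.
rewrite -[bigop _ _ _]/(prog_mean V q (draw_from X A s (up_moves s ++ down_moves s)) F).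
rewrite prog_mean_draw_from /step_mean !addr0.
have -> : (2^-1 + 2^-1 : R) = 1 by lra.
by rewrite divr1.
Qed.

(** All trajectories have length [T]; hence the final uniform draw divides by [T] and not by a
    random length. *)
Lemma eq_prog_mean_walk T s F G : (forall l, size l = T -> F l = G l) ->
  prog_mean V q (vgb_walk R H x T s) F = prog_mean V q (vgb_walk R H x T s) G.
Proof.
elim: T s F G => [|T IH] s F G FG /=; first exact: FG.
rewrite prog_mean_bind [RHS]prog_mean_bind; apply: eq_prog_mean => s'.
rewrite prog_mean_bind [RHS]prog_mean_bind; apply: IH => l sl /=.
by apply: FG; rewrite /= sl.
Qed.

(* The probability that the walk makes T steps without reaching a node with zero
   total weight, where the draw has no outcome. *)
Fixpoint survival T (s : seq A) : R :=
  if T is T'.+1 then step_mean (survival T') s else 1.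

(** A visit counts only on completed trajectories, hence the factor [survival T']. The starting node
    is not counted, since the output is drawn from times 1 to [T]. *)
Fixpoint visits (y : seq A) T (s : seq A) : R :=
  if T is T'.+1
  then step_mean (fun s' => (s' == y)%:R * survival T' s' + visits y T' s') s
  else 0.

Lemma prog_mean_walk_cst T s :
  prog_mean V q (vgb_walk R H x T s) (fun=> 1) = survival T s.
Proof.
elim: T s => [|T IH] s //=.
rewrite prog_mean_bind -prog_mean_vgb_step; apply: eq_prog_mean => s'.
by rewrite prog_mean_bind -IH.
Qed.

Lemma prog_mean_walk_visits y T s :
  prog_mean V q (vgb_walk R H x T s) (fun l => \sum_(u <- l) (u == y)%:R)
  = visits y T s.
Proof.
elim: T s => [|T IH] s /=; first by rewrite big_nil.
rewrite prog_mean_bind -prog_mean_vgb_step; apply: eq_prog_mean => s'.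
rewrite prog_mean_bind /=.
under eq_prog_mean do rewrite big_cons.
rewrite prog_meanD IH -prog_mean_walk_cst -prog_meanZ.
by under [in RHS]eq_prog_mean do rewrite mulr1.
Qed.

Lemma out_prob_vgb T y :
  out_prob V q (vgb R A H x T) y = visits y T [::] / T%:R.
Proof.
rewrite out_prob_mean /vgb prog_mean_bind.
under eq_prog_mean do rewrite prog_mean_draw_from !big_map /=.
rewrite (@eq_prog_mean_walk _ _ _ (fun l => T%:R^-1 * \sum_(u <- l) (u == y)%:R)).
  by rewrite prog_meanZ prog_mean_walk_visits mulrC.
move=> l sl; rewrite [RHS]mulrC; congr (_ / _).
  by apply: eq_bigr => u _; rewrite mul1r.
by rewrite big_const_seq count_predT sl iter_addr addr0.
Qed.

(** Each child costs one query to each oracle, and the parent edge one more evaluation of [V]. *)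
Lemma runtime_vgb_step s :
  (runtime V q (vgb_step R H x s) <= (#|A|).*2.+1)%N.
Proof.
have wc acts : (runtime V q (weigh_children R x s acts) <= (size acts).*2)%N.
  elim: acts => [|a acts IH] //=.
  rewrite doubleS !ltnS; apply: leq_trans (runtime_bind _ (n := 0%N) _) _ => //.
  by rewrite addn0.
rewrite -addn1 addnC; apply: leq_trans (runtime_bind _ (n := (#|A|).*2) _) _.
  move=> up; apply: leq_trans (runtime_bind _ (n := 0%N) _) _.
    move=> down; apply: leq_trans (runtime_bind _ (n := 0%N) _) _.
      by case=> //; rewrite runtime_draw_from.
    by rewrite runtime_draw_from.
  by rewrite addn0; case: ifP => // _; rewrite cardE wc.
by rewrite leq_add2r /weigh_parent; case: ifP.
Qed.

Lemma runtime_vgb T :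
  (runtime V q (vgb R A H x T) <= T * (#|A|).*2.+1)%N.
Proof.
apply: leq_trans (runtime_bind _ (n := 0%N) _) _.
  by move=> l; rewrite runtime_draw_from.
rewrite addn0; elim: T [::] => [|T IH] s //=.
apply: leq_trans (runtime_bind _ (n := (T * (#|A|).*2.+1)%N) _) _.
  move=> s'; apply: leq_trans (runtime_bind _ (n := 0%N) _) _ => //.
  by rewrite addn0.
by rewrite mulSn leq_add2r runtime_vgb_step.
Qed.

End Walk.

(** * Sums over levels, nodes and edges of the tree *)

Section NodeSums.
Variables (R : realType) (A : finType).
Implicit Types (F G : seq A -> R) (s y : seq A) (h H : nat).

(** Peeling off the last action makes the passage from a level to the children of its nodes hold by
    computation. *)
Fixpoint level_sum h F : R :=
  if h is h'.+1 then level_sum h' (fun s => \sum_a F (rcons s a)) else F [::].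

Lemma eq_level_sum h F G :
  (forall s, size s = h -> F s = G s) -> level_sum h F = level_sum h G.
Proof.
elim: h F G => [|h IH] F G FG /=; first exact: FG.
by apply: IH => s sh; apply: eq_bigr => a _; rewrite FG // size_rcons sh.
Qed.

Lemma level_sumD h F G :
  level_sum h (fun s => F s + G s) = level_sum h F + level_sum h G.
Proof.
elim: h F G => [|h IH] F G //=; rewrite -IH.
by apply: eq_level_sum => s _; rewrite big_split.
Qed.

Lemma level_sumZ h (k : R) F :
  level_sum h (fun s => k * F s) = k * level_sum h F.
Proof.
elim: h F => [|h IH] F //=; rewrite -IH.
by apply: eq_level_sum => s _; rewrite mulr_sumr.
Qed.

Lemma level_sum_ge0 h F :
  (forall s, size s = h -> 0 <= F s) -> 0 <= level_sum h F.
Proof.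
elim: h F => [|h IH] F F0 /=; first exact: F0.
by apply: IH => s sh; apply: sumr_ge0 => a _; rewrite F0 // size_rcons sh.
Qed.

Lemma level_sum_delta h y F :
  level_sum h (fun s => (s == y)%:R * F s) = (size y == h)%:R * F y.
Proof.
elim: h y F => [|h IH] y F /=; first by rewrite size_eq0 [[::] == y]eq_sym;
  case: eqVneq => [->|] //; rewrite !mul0r.
case/lastP: y => [|y b].
  rewrite (eq_level_sum (G := fun s => 0 * F s)); first by rewrite level_sumZ !mul0r.
  by move=> s _; rewrite mul0r big1 // => a _; case: s => [|? ?]; rewrite /= mul0r.
rewrite (eq_level_sum (G := fun s => (s == y)%:R * F (rcons s b))).
  by rewrite IH size_rcons.
move=> s _; rewrite (bigD1 b) //= eqseq_rcons eqxx andbT big1 ?addr0 // => a ab.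
by rewrite eqseq_rcons (negPf ab) andbF mul0r.
Qed.

Definition node_sum H F : R := \sum_(h < H.+1) level_sum h F.

Lemma eq_node_sum H F G :
  (forall s, (size s <= H)%N -> F s = G s) -> node_sum H F = node_sum H G.
Proof.
move=> FG; apply: eq_bigr => h _; apply: eq_level_sum => s sh.
by rewrite FG // sh -ltnS.
Qed.

Lemma node_sumD H F G :
  node_sum H (fun s => F s + G s) = node_sum H F + node_sum H G.
Proof.
by rewrite -big_split; apply: eq_bigr => h _; rewrite level_sumD.
Qed.

Lemma node_sumZ H (k : R) F :
  node_sum H (fun s => k * F s) = k * node_sum H F.
Proof.
by rewrite mulr_sumr; apply: eq_bigr => h _; rewrite level_sumZ.
Qed.

Lemma node_sumB H F G :
  node_sum H (fun s => F s - G s) = node_sum H F - node_sum H G.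
Proof.
rewrite -[X in _ = _ + X]mulN1r -node_sumZ -node_sumD.
by apply: eq_node_sum => s _; rewrite mulN1r.
Qed.

Lemma node_sum_ge0 H F :
  (forall s, (size s <= H)%N -> 0 <= F s) -> 0 <= node_sum H F.
Proof.
move=> F0; apply: sumr_ge0 => h _; apply: level_sum_ge0 => s sh.
by apply: F0; rewrite sh -ltnS.
Qed.

Lemma node_sum_delta H y F : (size y <= H)%N ->
  node_sum H (fun s => (s == y)%:R * F s) = F y.
Proof.
move=> yH; rewrite /node_sum.
under eq_bigr do rewrite level_sum_delta.
rewrite (bigD1 (Ordinal (yH : (size y < H.+1)%N))) //= eqxx mul1r.
by rewrite big1 ?addr0 // => h; rewrite -val_eqE /= eq_sym => /negPf ->; rewrite mul0r.
Qed.

Definition parent s := take (size s).-1 s.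

Lemma parent_rcons s a : parent (rcons s a) = s.
Proof. by rewrite /parent size_rcons /= -cats1 take_size_cat. Qed.

(** Both sides run over the edges of the tree, indexed by the lower endpoint on the left and by the
    upper one on the right. *)
Lemma node_sum_parent H (K : seq A -> seq A -> R) :
  node_sum H (fun s => (0 < size s)%:R * K (parent s) s)
  = node_sum H (fun s => (size s < H)%:R * \sum_a K s (rcons s a)).
Proof.
rewrite /node_sum big_ord_recl [in RHS]big_ord_recr /= mul0r add0r.
rewrite [X in _ = _ + X](eq_level_sum (G := fun s => 0 * 0)); last first.
  by move=> s ->; rewrite ltnn !mul0r.
rewrite level_sumZ mul0r addr0; apply: eq_bigr => h _ /=.
apply: eq_level_sum => s ->; rewrite ltn_ord mul1r.
by apply: eq_bigr => a _; rewrite size_rcons mul1r parent_rcons.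
Qed.

End NodeSums.

(** * Reversibility of the walk and self-adjointness of its operator *)

Section Reversible.
Variables (R : realType) (X : Type) (A : finType) (H : nat).
Variables (V : X -> seq A -> R) (q : X -> seq A -> A -> R) (x : X).
Variable p : seq A -> R.
Hypothesis pq : forall s a, (size s < H)%N -> p s * q x s a = p (rcons s a).
Hypothesis p0 : forall s, 0 <= p s.
Hypothesis q0 : forall s a, 0 <= q x s a.
Hypothesis V0 : forall s, (size s <= H)%N -> 0 <= V x s.

(* The weight of the edge from [s] to its parent, 0 at the root. *)
Definition edge (s : seq A) : R := (0 < size s)%:R * (p s * V x s).

Definition weight (s : seq A) : R :=
  edge s + (size s < H)%:R * \sum_a edge (rcons s a).

Local Notation P := (step_mean H V q x).

Lemma edge_ge0 s : (size s <= H)%N -> 0 <= edge s.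
Proof. by move=> sH; rewrite !mulr_ge0 ?p0 ?V0. Qed.

Lemma weight_ge0 s : (size s <= H)%N -> 0 <= weight s.
Proof.
move=> sH; rewrite addr_ge0 ?edge_ge0 //.
case: ltnP => sH'; last by rewrite mul0r.
by rewrite mul1r sumr_ge0 // => a _; rewrite edge_ge0 // size_rcons.
Qed.

Lemma sum_moves (G : seq A * R -> R) s :
  \sum_(z <- moves H V q x s) G z
  = (0 < size s)%:R * G (parent s, V x s)
    + (size s < H)%:R
      * \sum_a G (rcons s a, q x s a * V x (rcons s a)).
Proof.
rewrite big_cat /up_moves /down_moves; congr (_ + _).
  by case: ltnP => _; rewrite ?big_seq1 ?big_nil ?mul1r ?mul0r.
case: ltnP => _; last by rewrite big_nil mul0r.
by rewrite big_map big_enum mul1r.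
Qed.

(** By the chain rule [pq], the factor [p s] turns the weights used at [s] into edge weights. An
    edge gets the same weight from both of its ends, which is reversibility. *)
Lemma p_moves (F : seq A -> R) s : (size s <= H)%N ->
  p s * \sum_(z <- moves H V q x s) z.2 * F z.1
  = edge s * F (parent s)
    + (size s < H)%:R * \sum_a edge (rcons s a) * F (rcons s a).
Proof.
move=> sH; rewrite sum_moves mulrDr; congr (_ + _).
  by rewrite /edge /=; ring.
case: ltnP => sH'; last by rewrite !mul0r mulr0.
rewrite !mul1r mulr_sumr; apply: eq_bigr => a _ /=.
by rewrite /edge size_rcons -pq //=; ring.
Qed.

Lemma p_total s : (size s <= H)%N ->
  p s * \sum_(z <- moves H V q x s) z.2 = weight s.
Proof.
move=> sH; have := p_moves (fun=> 1) sH.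
under eq_bigr do rewrite mulr1.
by under [in X in _ = X]eq_bigr do rewrite mulr1; rewrite mulr1.
Qed.

Lemma moves_ge0 s z : (size s <= H)%N -> z \in moves H V q x s -> 0 <= z.2.
Proof.
move=> sH; rewrite mem_cat /up_moves /down_moves; case/orP.
  by case: ltnP => // _; rewrite inE => /eqP ->; exact: V0.
case: ltnP => // sH' /mapP[a _ ->] /=.
by rewrite mulr_ge0 ?q0 ?V0 ?size_rcons.
Qed.

Lemma weight_step (F : seq A -> R) s : (size s <= H)%N ->
  weight s * P F s
  = 2^-1 * (weight s * F s)
    + 2^-1 * (edge s * F (parent s)
              + (size s < H)%:R * \sum_a edge (rcons s a) * F (rcons s a)).
Proof.
move=> sH; rewrite -p_moves // -p_total // /step_mean.
set D := \sum_(z <- _) z.2; set N := \sum_(z <- _) _.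
(* If the total [D] is 0, every weight is 0 by nonnegativity, so the numerator vanishes as well. *)
case: (eqVneq D 0) => [D0|Dn0]; last by field.
suff -> : N = 0 by rewrite D0; ring.
rewrite /N big_seq big1 // => z zs.
have /allP/(_ z zs)/eqP -> : all (fun z => z.2 == 0) (moves H V q x s).
  by move/eqP: D0; rewrite /D big_seq psumr_eq0 => [/allP D0|u /(moves_ge0 sH)//];
     apply/allP => u us; have := D0 u us; rewrite us.
by rewrite mul0r.
Qed.

Definition dot (F G : seq A -> R) := node_sum H (fun s => weight s * (F s * G s)).

(** The lazy part is symmetric in [F] and [G]. The rest splits by [node_sum_parent] into two sums
    over edges, which are exchanged when [F] and [G] are. *)
Lemma dot_step F G : dot F (P G) = dot (P F) G.
Proof.
have sym : forall F G, dot F (P G) = 2^-1 * dot F G + 2^-1 *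
   (node_sum H (fun s => edge s * (F s * G (parent s)))
    + node_sum H (fun s => edge s * (F (parent s) * G s))).
  move=> {}F {}G.
  have -> : node_sum H (fun s => edge s * (F (parent s) * G s)) =
      node_sum H (fun s => (size s < H)%:R * \sum_a edge (rcons s a) * (F s * G (rcons s a))).
    rewrite -(node_sum_parent H (fun s t => edge t * (F s * G t))).
    by apply: eq_node_sum => s _; rewrite /edge; case: (0 < size s)%N; rewrite ?mul1r ?mul0r.
  rewrite -node_sumD -!node_sumZ -node_sumD; apply: eq_node_sum => s sH.
  rewrite mulrCA weight_step //.
  under [X in _ = _ + _ * (_ + _ * X)]eq_bigr do rewrite mulrCA.
  by rewrite -mulr_sumr; ring.
have dotC F' G' : dot F' G' = dot G' F'.
  by apply: eq_node_sum => s _; rewrite [F' s * _]mulrC.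
rewrite sym [RHS]dotC sym dotC [X in _ + _ * X]addrC.
by congr (_ + _ * (_ + _)); apply: eq_node_sum => s _; rewrite [F _ * _]mulrC.
Qed.

(** The factor [weight s] is essential: at a node whose moves all have weight 0, [P] maps 1 to
    1/2. *)
Lemma weight_step1 s : (size s <= H)%N -> weight s * P (fun=> 1) s = weight s.
Proof.
move=> sH; rewrite weight_step //; under eq_bigr do rewrite mulr1.
by rewrite !mulr1 -/(weight s); field.
Qed.

Lemma dot_step1 F : dot (P F) (fun=> 1) = dot F (fun=> 1).
Proof.
rewrite -dot_step; apply: eq_node_sum => s sH.
by rewrite mulrCA weight_step1 // mulr1 mulrC.
Qed.

Lemma dot_survival T F : dot F (survival H V q x T) = dot F (fun=> 1).
Proof. by elim: T F => //= T IH F; rewrite dot_step IH dot_step1. Qed.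

Lemma dot_delta y F : (size y <= H)%N ->
  dot (fun s => (s == y)%:R) F = weight y * F y.
Proof.
move=> yH; rewrite -(node_sum_delta (fun s => weight s * F s) yH).
by apply: eq_node_sum => s _; rewrite mulrCA.
Qed.

(** Testing against the indicator of [y] and moving [P] across [dot] shows that no mass is lost from
    [y]: nodes of weight 0 are invisible to [dot]. *)
Lemma survival1 T y : (size y <= H)%N -> 0 < weight y ->
  survival H V q x T y = 1.
Proof.
move=> yH y0; apply: (mulfI (lt0r_neq0 y0)).
by rewrite -!dot_delta // dot_survival.
Qed.

Lemma step_mean_ge0 F s : (forall s, (size s <= H)%N -> 0 <= F s) ->
  (size s <= H)%N -> 0 <= P F s.
Proof.
move=> F0 sH; rewrite addr_ge0 ?mulr_ge0 ?F0 ?invr_ge0 //.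
  rewrite sum_moves addr_ge0 //=.
    rewrite !mulr_ge0 ?V0 ?F0 // (leq_trans _ sH) // size_take.
    by case: ifP => //; lia.
  case: ltnP => sH'; rewrite ?mul0r // mul1r; apply: sumr_ge0 => a _.
  by rewrite !mulr_ge0 ?q0 ?V0 ?F0 ?size_rcons.
by rewrite big_seq sumr_ge0 // => z /(moves_ge0 sH).
Qed.

Lemma step_meanB F G s : P (fun s => F s - G s) s = P F s - P G s.
Proof.
rewrite /step_mean; have -> : \sum_(z <- moves H V q x s) z.2 * (F z.1 - G z.1)
  = \sum_(z <- moves H V q x s) z.2 * F z.1
    - \sum_(z <- moves H V q x s) z.2 * G z.1.
  by rewrite -sumrB; apply: eq_bigr => z _; rewrite mulrBr.
by ring.
Qed.

(** * Climbing times and the lower bound on visits *)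

Section Hitting.
(* [M s] is the total weight of the subtree of [s]. *)
Variable M : seq A -> R.
Hypothesis M0 : forall s, (size s <= H)%N -> 0 <= M s.
Hypothesis MS : forall s, (size s <= H)%N ->
  M s = weight s + (size s < H)%:R * \sum_a M (rcons s a).
Hypothesis Medge : forall s, (0 < size s <= H)%N -> edge s = 0 -> M s = 0.

(* The mean time to go from [s] to its parent, then from [s] to the root. *)
Definition climb (s : seq A) : R := 2 * M s / edge s.
Definition hitting (s : seq A) : R := \sum_(j < size s) climb (take j.+1 s).

(** On an edge of weight 0 the quotient in [climb] is 0, and [Medge] makes the right side 0 too. *)
Lemma edge_climb s : (0 < size s <= H)%N -> edge s * climb s = 2 * M s.
Proof.
move=> sH; rewrite /climb mulrC.
case: (eqVneq (edge s) 0) => [e0|]; last by move/divfK.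
by rewrite e0 Medge // !mulr0.
Qed.

Lemma hitting_rcons s a : hitting (rcons s a) = hitting s + climb (rcons s a).
Proof.
rewrite /hitting size_rcons big_ord_recr /= -(size_rcons s a) take_size.
congr (_ + _); apply: eq_bigr => j _.
by rewrite -cats1 takel_cat.
Qed.

Lemma hitting_ge0 s : (size s <= H)%N -> 0 <= hitting s.
Proof.
move=> sH; apply: sumr_ge0 => j _.
have tH : (size (take j.+1 s) <= H)%N by rewrite size_takel // (leq_trans _ sH).
by apply: divr_ge0; [rewrite mulr_ge0 ?M0|exact: edge_ge0].
Qed.

Lemma hitting_parent s : (0 < size s)%N -> hitting s = hitting (parent s) + climb s.
Proof.
by case/lastP: s => // s a _; rewrite parent_rcons hitting_rcons.
Qed.

(* Poisson's equation for the indicator of the root. *)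
Lemma hitting_poisson s : (size s <= H)%N ->
  weight s * (hitting s - P hitting s) = weight s - (s == [::])%:R * M [::].
Proof.
move=> sH; rewrite mulrBr weight_step //.
(* The climbs from the children contribute twice their subtree weights, which add up to
   [M s - weight s] by [MS]. The factor 2 offsets the laziness in [weight_step]. *)
have -> : (size s < H)%:R * (\sum_a edge (rcons s a) * hitting (rcons s a))
   = (weight s - edge s) * hitting s + 2 * (M s - weight s).
  rewrite [X in _ + 2 * (X - _)]MS // /weight.
  case: ltnP => sH'; last by rewrite !mul0r; ring.
  rewrite !mul1r.
  under eq_bigr do rewrite hitting_rcons mulrDr edge_climb ?size_rcons //.
  by rewrite big_split /= -mulr_suml -mulr_sumr; ring.
case: (eqVneq s [::]) => [->|sn].
  by rewrite /edge /= mul1r; field.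
have s0 : (0 < size s)%N by case: (s) sn.
have es : edge s * climb s = 2 * M s by rewrite edge_climb ?s0.
rewrite hitting_parent // !mulrDr.
by rewrite mul0r subr0; lra.
Qed.

(** Poisson's equation tested against [F], with [P] moved onto [F] by self-adjointness. *)
Lemma dot_hitting F : dot F hitting - dot (P F) hitting = dot F (fun=> 1) - M [::] * F [::].
Proof.
rewrite -dot_step -node_sumB.
rewrite -(node_sum_delta (fun s => M [::] * F s) (leq0n H : (size [::] <= H)%N)) -node_sumB.
apply: eq_node_sum => s sH.
rewrite -mulrBr -mulrBr mulrCA hitting_poisson //; ring.
Qed.

(** Let [U T] be the visits to [y] and [F] the indicator of [y] plus [U T], so that [P F = U T.+1].
    Then [dot_hitting] turns the right side into the left side plus
    [dot (U T.+1) hitting - dot (U T) hitting], which is nonnegative since visits increase with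
    [T]. *)
Lemma visits_root T y : (0 < size y <= H)%N -> 0 < weight y ->
  weight y * (T.+1%:R - hitting y) <= M [::] * visits H V q x y T [::].
Proof.
case/andP=> y0 yH w0.
pose U T := visits H V q x y T.
(* The survival factor matters only at [y], where it is 1 by [survival1]. *)
have US T' : U T'.+1 = P (fun s => (s == y)%:R + U T' s).
  suff <- : (fun s => (s == y)%:R * survival H V q x T' s + U T' s)
            = (fun s => (s == y)%:R + U T' s) by [].
  apply/funext => s; congr (_ + _).
  by case: eqVneq => [->|_]; [rewrite survival1 ?mulr1|rewrite mul0r].
have U0 s : U 0%N s = 0 by [].
rewrite -/(U T); clearbody U.
have mono T' s : (size s <= H)%N -> 0 <= U T'.+1 s - U T' s.
  elim: T' s => [|T' IH] s sH.
    by rewrite US U0 subr0; apply: step_mean_ge0 => // t tH; rewrite U0 addr0.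
  rewrite [U T'.+2]US [U T'.+1 in X in _ - X]US -step_meanB.
  apply: step_mean_ge0 => // t tH.
  by rewrite opprD addrACA subrr add0r IH.
have dotD F G K : dot (fun s => F s + G s) K = dot F K + dot G K.
  by rewrite -node_sumD; apply: eq_node_sum => s _; ring.
(* [weight] is stationary, so each step adds [weight y] to the total. *)
have one T' : dot (U T') (fun=> 1) = T'%:R * weight y.
  elim: T' => [|T' IH].
    rewrite mul0r /dot (eq_node_sum (G := fun s => 0 * 0)) ?node_sumZ ?mul0r //.
    by move=> s _; rewrite U0; ring.
  by rewrite US dot_step1 dotD dot_delta // IH -natr1; ring.
have := dot_hitting (fun s => (s == y)%:R + U T s).
rewrite -US !dotD !dot_delta // one.
have -> : ([::] == y) = false by case: (y) y0.
rewrite add0r => eqT.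
have : 0 <= dot (U T.+1) hitting - dot (U T) hitting.
  rewrite -node_sumB; apply: node_sum_ge0 => s sH.
  rewrite -mulrBr -mulrBl mulr_ge0 ?weight_ge0 // mulr_ge0 ?mono //.
  exact: hitting_ge0.
rewrite -natr1; lra.
Qed.

End Hitting.
End Reversible.

(** * Quotients in the extended reals, Markov's inequality and a union bound *)

(** A finite bound excludes infinite terms, so [b] cannot vanish where [p] and [a] are positive.
    Elsewhere the real quotient, 0 for a zero denominator, is at most the extended one. *)
Lemma expect_div_le (R : realType) (I : finType) (p a b : I -> R) (B : R) :
  (forall i, 0 <= p i) -> (forall i, 0 <= a i) -> (forall i, 0 <= b i) ->
  (expect p (fun i => (a i)%:E / (b i)%:E) <= B%:E)%E ->
  \sum_i p i * (a i / b i) <= B /\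
  forall i, 0 < p i -> 0 < a i -> 0 < b i.
Proof.
move=> p0 a0 b0 leB.
have term0 i : (0 <= (p i)%:E * ((a i)%:E / (b i)%:E))%E.
  rewrite mule_ge0 ?lee_fin // mule_ge0 ?lee_fin // inver.
  by case: ifP => // _; rewrite lee_fin invr_ge0.
split.
  rewrite -lee_fin; apply: le_trans leB; rewrite -sumEFin.
  apply: lee_sum => i _; rewrite EFinM lee_wpmul2l ?lee_fin // inver.
  case: eqVneq => [->|_]; last by rewrite EFinM.
  by rewrite invr0 mulr0 mule_ge0 ?lee_fin // leey.
move=> i pi0 ai0; rewrite lt0r b0 andbT; apply/eqP => bi0.
move: leB; rewrite /expect (bigD1 i) //= inver bi0 eqxx.
rewrite !gt0_muley ?lte_fin //.
rewrite addye ?leye_eq // gt_eqF //; apply: (@lt_le_trans _ _ 0%E) => //.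
by apply: sume_ge0.
Qed.

Lemma markov_prob_of (R : realType) (I : finType) (p f : I -> R) (B l : R) :
  (forall i, 0 <= p i) -> (forall i, 0 <= f i) -> 0 < l ->
  \sum_i p i * f i <= B -> prob_of p (fun i => l < f i) <= B / l.
Proof.
move=> p0 f0 l0 leB; rewrite ler_pdivlMr //; apply: le_trans leB.
rewrite /prob_of mulr_suml big_mkcond; apply: ler_sum => i _.
case: ifP => [/ltW lf|_]; last by rewrite mulr_ge0.
by rewrite ler_wpM2l.
Qed.

Lemma prob_of_union3 (R : realType) (I : finType) (p : I -> R)
  (E E1 E2 E3 : pred I) : (forall i, 0 <= p i) ->
  (forall i, 0 < p i -> E i -> [|| E1 i, E2 i | E3 i]) ->
  prob_of p E <= prob_of p E1 + prob_of p E2 + prob_of p E3.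
Proof.
move=> p0 sub; rewrite /prob_of [X in X <= _]big_mkcond.
rewrite (big_mkcond E1) (big_mkcond E2) (big_mkcond E3) -!big_split /=.
apply: ler_sum => i _; have := p0 i; rewrite le_eqVlt => /predU1P[<-|pi0].
  by rewrite !if_same !addr0.
case: ifP => [/(sub _ pi0)|_]; last by rewrite !addr_ge0 //; case: ifP.
have := p0 i.
by case: (E1 i); case: (E2 i); case: (E3 i) => //= + _; lra.
Qed.

(** * Prefix probabilities *)

Section Prefixes.
Variables (R : realType) (A : finType) (H : nat).
Implicit Types (u v : H.-tuple A -> R) (s : seq A) (y : H.-tuple A).

Lemma size_take_tuple j y : (j <= H)%N -> size (take j y) = j.
Proof. by move=> jH; rewrite size_takel // size_tuple. Qed.

Lemma prefix_prob_ge0 u s : (forall y, 0 <= u y) -> 0 <= prefix_prob u s.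
Proof. by move=> u0; apply: sumr_ge0. Qed.

Lemma prefix_prob_rcons u s : (size s < H)%N ->
  \sum_a prefix_prob u (rcons s a) = prefix_prob u s.
Proof.
move=> sH; rewrite /prefix_prob.
under eq_bigr do rewrite size_rcons big_mkcond.
rewrite exchange_big [RHS]big_mkcond; apply: eq_bigr => y _ /=.
have ys : (size s < size y)%N by rewrite size_tuple.
pose b := tnth y (Ordinal sH).
under eq_bigr do rewrite (take_nth b ys) eqseq_rcons.
case: eqVneq => _ /=; last by rewrite big1.
by rewrite -big_mkcond (big_pred1 (nth b y (size s))) // => a; rewrite eq_sym.
Qed.

Lemma prefix_prob_eq0 u s y : (forall y, 0 <= u y) ->
  prefix_prob u s = 0 -> take (size s) y == s -> u y = 0.
Proof.
move=> u0 /eqP; rewrite psumr_eq0 // => /allP/(_ y) us sy.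
by apply/eqP; move: us; rewrite mem_index_enum sy; apply.
Qed.

Lemma prefix_prob_full u y : prefix_prob u y = u y.
Proof.
rewrite /prefix_prob (big_pred1 y) // => z /=.
by rewrite size_tuple -[X in take X z](size_tuple z) take_size.
Qed.

(** The tower property: summing [u] over the sequences with a given prefix cancels the denominator.
    Only an inequality, because prefixes with [prefix_prob u] equal to 0 drop out on the left. *)
Lemma prefix_prob_cond u v j : (j <= H)%N ->
  (forall y, 0 <= v y) ->
  \sum_y u y * (prefix_prob v (take j y) / prefix_prob u (take j y))
  <= \sum_y v y.
Proof.
move=> jH v0.
have -> : \sum_y u y * (prefix_prob v (take j y) / prefix_prob u (take j y)) =
    \sum_(z : H.-tuple A) v z * (prefix_prob u (take j z) / prefix_prob u (take j z)).
  transitivity (\sum_(y : H.-tuple A) \sum_(z : H.-tuple A) (take j z == take j y)%:R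
                  * (u y * v z / prefix_prob u (take j y))).
    apply: eq_bigr => y _; rewrite mulrA [X in _ * X / _]big_mkcond mulr_sumr mulr_suml.
    apply: eq_bigr => z _; rewrite size_take_tuple //.
    by case: eqP => _; rewrite ?mul1r // mulr0 !mul0r.
  rewrite exchange_big; apply: eq_bigr => z _ /=.
  rewrite mulrA [X in _ = _ * X / _]big_mkcond mulr_sumr mulr_suml.
  apply: eq_bigr => y _; rewrite size_take_tuple // eq_sym.
  by case: eqP => [->|_]; rewrite ?mul1r 1?[u y * _]mulrC // mulr0 !mul0r.
apply: ler_sum => z _; case: (eqVneq (prefix_prob u (take j z)) 0) => [->|n0].
  by rewrite mul0r mulr0.
by rewrite divff ?mulr1.
Qed.

End Prefixes.

(** * Bounds for the tilted target under the accuracy assumptions *)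

Section Alignment.
Variables (R : realType) (A : finType) (H : nat) (X : Type).
Variables (p t : H.-tuple A -> R) (Vhat : X -> seq A -> R).
Variables (q : X -> seq A -> A -> R) (x : X) (epsV delta : R).
Implicit Types (s : seq A) (y : H.-tuple A).
Hypothesis H_gt0 : (0 < H)%N.
Hypothesis p_ge0 : forall y, 0 <= p y.
Hypothesis t_ge0 : forall y, 0 <= t y.
Hypothesis Z_gt0 : 0 < normalizer p t.
Hypothesis V_ge0 : forall s, (size s <= H)%N -> 0 <= Vhat x s.
Hypothesis q_next : forall s a, q x s a = next_prob p s a.
Hypothesis epsV_ge0 : 0 <= epsV.
Hypothesis delta_gt0 : 0 < delta.
Local Notation V := (Vhat x).
Local Notation Vstar := (cond_expect p t).
Local Notation pistar := (tilt p t).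
Local Notation Z := (normalizer p t).
Hypothesis V_supp : forall s, (1 <= size s <= H)%N -> 0 < prefix_prob p s ->
  Vstar s = 0 -> V s = 0.

Let ratio s := V s / Vstar s.
Let ratioV s := Vstar s / V s.
Hypothesis mean_ratio : forall h, (1 <= h <= H)%N ->
  \sum_y pistar y * ratio (take h y) <= 1 + epsV.
Hypothesis mean_ratioV : forall h, (1 <= h <= H)%N ->
  \sum_y pistar y * ratioV (take h y) <= 1 + epsV.
Hypothesis V_gt0 : forall h y, (1 <= h <= H)%N -> 0 < pistar y ->
  0 < Vstar (take h y) -> 0 < V (take h y).

Let tilted y := p y * t y.
Let mass s := prefix_prob tilted s.

Lemma tilted_ge0 y : 0 <= tilted y. Proof. exact: mulr_ge0. Qed.

Lemma tilted_pistar y : tilted y = Z * pistar y.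
Proof. by rewrite mulrC divfK // gt_eqF. Qed.

Lemma pistar_ge0 y : 0 <= pistar y.
Proof. by rewrite divr_ge0 ?tilted_ge0 // ltW. Qed.

Lemma Vstar_ge0 s : 0 <= Vstar s.
Proof.
by apply: divr_ge0; apply: prefix_prob_ge0 => // y; apply: tilted_ge0.
Qed.

Lemma ratio_ge0 s : (size s <= H)%N -> 0 <= ratio s.
Proof. by move=> sH; rewrite divr_ge0 ?V_ge0 ?Vstar_ge0. Qed.

Lemma ratioV_ge0 s : (size s <= H)%N -> 0 <= ratioV s.
Proof. by move=> sH; rewrite divr_ge0 ?V_ge0 ?Vstar_ge0. Qed.

Lemma ratio_take_ge0 h y : 0 <= ratio (take h y).
Proof. by rewrite ratio_ge0 // size_take size_tuple; case: ifP => // /ltnW. Qed.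

Lemma ratioV_take_ge0 h y : 0 <= ratioV (take h y).
Proof. by rewrite ratioV_ge0 // size_take size_tuple; case: ifP => // /ltnW. Qed.

Lemma q_ge0 s a : 0 <= q x s a.
Proof. by rewrite q_next divr_ge0 ?prefix_prob_ge0. Qed.

Lemma prefix_next s a : (size s < H)%N ->
  prefix_prob p s * q x s a = prefix_prob p (rcons s a).
Proof.
move=> sH; rewrite q_next /next_prob mulrC.
case: (eqVneq (prefix_prob p s) 0) => [p0|]; last by move/divfK.
move: (prefix_prob_rcons p sH); rewrite p0 mulr0 => /eqP.
rewrite psumr_eq0; last by move=> b _; apply: prefix_prob_ge0.
by move=> /allP/(_ a); rewrite mem_index_enum => /(_ isT)/eqP ->.
Qed.

Lemma mass_eq0 s : prefix_prob p s = 0 -> mass s = 0.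
Proof.
move=> p0; apply: big1 => y sy.
by rewrite /tilted (prefix_prob_eq0 _ p0 sy) ?mul0r.
Qed.

Lemma Vstar_gt0 h y : (h <= H)%N -> 0 < pistar y ->
  0 < mass (take h y) /\ 0 < Vstar (take h y).
Proof.
move=> hH y0.
have m0 : 0 < mass (take h y).
  rewrite lt0r (prefix_prob_ge0 _ tilted_ge0) andbT; apply: contraTN y0 => /eqP m0.
  have /(prefix_prob_eq0 tilted_ge0 m0) : take (size (take h y)) y == take h y.
    by rewrite size_take_tuple.
  rewrite tilted_pistar => /eqP; rewrite mulf_eq0 (gt_eqF Z_gt0) /=.
  by move/eqP->; rewrite ltxx.
split=> //; rewrite divr_gt0 // lt0r prefix_prob_ge0 // andbT.
by apply: contraTN m0 => /eqP/mass_eq0 ->; rewrite ltxx.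
Qed.

Local Notation edge := (edge Vhat x (prefix_prob p)).
Local Notation weight := (weight H Vhat x (prefix_prob p)).

(** Where [Vstar s] is 0, [ratio s] is 0 by convention; [V_supp] then ensures that the edge has
    weight 0 too. *)
Lemma edge_ratio s : (size s <= H)%N -> edge s = (0 < size s)%:R * (mass s * ratio s).
Proof.
move=> sH; rewrite /edge; case: ltnP => s0; last by rewrite !mul0r.
rewrite !mul1r /ratio.
case: (eqVneq (prefix_prob p s) 0) => [p0|pn0].
  by rewrite p0 (mass_eq0 p0) !mul0r.
case: (eqVneq (Vstar s) 0) => [v0|vn0].
  by rewrite V_supp ?s0 ?lt0r ?pn0 ?prefix_prob_ge0 // mul0r !mulr0.
have -> : mass s = prefix_prob p s * Vstar s by rewrite mulrC divfK.
by field.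
Qed.

(* Total weight of the edges at or below [s], the edge to the parent of [s]
   included. *)
Definition subtree (s : seq A) : R :=
  prefix_prob (fun y => tilted y
    * \sum_(maxn 1 (size s) <= h < H.+1) ratio (take h y)) s.

Lemma sum_ratio_ge0 j y : 0 <= \sum_(j <= h < H.+1) ratio (take h y).
Proof. by apply: sumr_ge0 => h _; apply: ratio_take_ge0. Qed.

Lemma subtree_ge0 s : 0 <= subtree s.
Proof.
by apply: prefix_prob_ge0 => y; rewrite mulr_ge0 ?tilted_ge0 ?sum_ratio_ge0.
Qed.

(** Level [size s] contributes the edge of [s], and the deeper levels split over the children. At
    the root, [maxn 1] skips level 0, which has no edge. *)
Lemma subtreeE s : (size s <= H)%N ->
  subtree s = edge s + (size s < H)%:R * \sum_a subtree (rcons s a).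
Proof.
move=> sH.
have -> : (size s < H)%:R * (\sum_a subtree (rcons s a)) =
    prefix_prob (fun y => tilted y
      * \sum_((size s).+1 <= h < H.+1) ratio (take h y)) s.
  case: ltnP => sH'.
    rewrite mul1r -prefix_prob_rcons //; apply: eq_bigr => a _.
    by rewrite /subtree size_rcons maxnE subn1 add1n.
  rewrite mul0r; apply/esym/big1 => y _.
  by rewrite big_geq ?mulr0 // ltnS.
rewrite edge_ratio // /subtree; case: (posnP (size s)) => [s0|s0].
  by rewrite s0 mul0r add0r.
rewrite mul1r /mass /prefix_prob mulr_suml -big_split /=.
apply: eq_bigr => y /eqP sy.
by rewrite (maxn_idPr s0) big_ltn ?ltnS // sy mulrDr.
Qed.

(** Edges below [s] count at both endpoints, the edge from [s] to its parent only at [s]. *)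
Definition subtree_weight s := 2 * subtree s - edge s.

Lemma edge_le_subtree s : (size s <= H)%N -> edge s <= subtree s.
Proof.
move=> sH; rewrite subtreeE // lerDl mulr_ge0 // sumr_ge0 // => a _.
exact: subtree_ge0.
Qed.

Lemma subtree_weight_ge0 s : (size s <= H)%N -> 0 <= subtree_weight s.
Proof.
move=> sH; rewrite /subtree_weight.
have := edge_le_subtree sH; have := subtree_ge0 s; lra.
Qed.

Lemma subtree_weightE s : (size s <= H)%N ->
  subtree_weight s
  = weight s + (size s < H)%:R * \sum_a subtree_weight (rcons s a).
Proof.
move=> sH; rewrite /subtree_weight subtreeE // /weight.
case: ltnP => _; last by rewrite !mul0r; ring.
by rewrite !mul1r sumrB -mulr_sumr; ring.
Qed.

(** A leaf below [s] with positive target probability would make [mass s], [Vstar s] and [V s]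
    positive, hence also the edge. *)
Lemma subtree_weight_eq0 s : (0 < size s <= H)%N -> edge s = 0 ->
  subtree_weight s = 0.
Proof.
move=> /andP[s0 sH] e0; rewrite /subtree_weight e0 subr0.
suff -> : subtree s = 0 by rewrite mulr0.
apply: big1 => y /eqP sy.
suff -> : tilted y = 0 by rewrite mul0r.
have := pistar_ge0 y; rewrite tilted_pistar le_eqVlt => /predU1P[<-|y0].
  by rewrite mulr0.
have [m0 v0] := Vstar_gt0 sH y0.
have r0 : 0 < V (take (size s) y) by apply: V_gt0 => //; rewrite s0.
rewrite sy in m0 v0 r0; move: e0; rewrite edge_ratio // s0 mul1r => /eqP; rewrite gt_eqF //.
by rewrite mulr_gt0 // divr_gt0.
Qed.

Lemma mean_tilted (f : H.-tuple A -> R) B :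
  \sum_y pistar y * f y <= B -> \sum_y tilted y * f y <= Z * B.
Proof.
move=> fB; have -> : \sum_y tilted y * f y = Z * \sum_y pistar y * f y.
  by rewrite mulr_sumr; apply: eq_bigr => y _; rewrite tilted_pistar mulrA.
by rewrite ler_wpM2l // ltW.
Qed.

Lemma mean_level_sum (f : nat -> H.-tuple A -> R) B :
  (forall h, (1 <= h <= H)%N -> \sum_y pistar y * f h y <= B) ->
  \sum_y pistar y * (\sum_(1 <= h < H.+1) f h y) <= H%:R * B.
Proof.
move=> fB; under eq_bigr do rewrite mulr_sumr.
rewrite exchange_big /=.
apply: (@le_trans _ _ (\sum_(1 <= h < H.+1) B)).
  by apply: ler_sum_nat => h hH; apply: fB.
by rewrite sumr_const_nat subn1 mulr_natl.
Qed.

Lemma subtree_root : subtree_weight [::] <= 2 * (Z * (H%:R * (1 + epsV))).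
Proof.
rewrite /subtree_weight edge_ratio // mul0r subr0 ler_pM2l //.
have -> : subtree [::] = \sum_y tilted y * \sum_(1 <= h < H.+1) ratio (take h y).
  by apply: eq_bigl => y; rewrite take0 eqxx.
by apply: mean_tilted; apply: mean_level_sum.
Qed.

(** For nonempty [s], the conditional mean under [pistar], given the prefix [s], of the sum of
    [ratio] over the levels from [size s] to [H]. *)
Let load s := subtree s / mass s.

Lemma load_ge0 s : 0 <= load s.
Proof. by rewrite divr_ge0 ?subtree_ge0 ?prefix_prob_ge0 //; apply: tilted_ge0. Qed.

(** Averaging removes the conditioning, by [prefix_prob_cond]; the sum over the levels from [j] on
    is then enlarged to all levels. *)
Lemma mean_load j : (1 <= j <= H)%N ->
  \sum_y pistar y * load (take j y) <= H%:R * (1 + epsV).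
Proof.
move=> /andP[j0 jH]; rewrite -(ler_pM2l Z_gt0).
pose v y := tilted y * \sum_(j <= h < H.+1) ratio (take h y).
have v_ge0 y : 0 <= v y by rewrite mulr_ge0 ?tilted_ge0 ?sum_ratio_ge0.
apply: le_trans (_ : \sum_y v y <= _).
  apply: le_trans (prefix_prob_cond tilted jH v_ge0).
  rewrite mulr_sumr le_eqVlt; apply/orP; left; apply/eqP.
  apply: eq_bigr => y _; rewrite tilted_pistar /load /subtree.
  by rewrite size_take_tuple // (maxn_idPr j0) !mulrA.
apply: le_trans (mean_tilted (mean_level_sum mean_ratio)).
apply: ler_sum => y _; rewrite ler_wpM2l ?tilted_ge0 //.
rewrite [leRHS](@big_cat_nat _ _ _ j) //= ?lerDr ?sum_ratio_ge0 ?(leq_trans jH) //.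
by apply: sumr_ge0 => h _; apply: ratio_take_ge0.
Qed.

Local Notation hitting := (hitting Vhat x (prefix_prob p) subtree_weight).

(** Dropping [- edge s] from [subtree_weight s] leaves [4 * subtree s / edge s], where [edge s] is
    [mass s * ratio s]. *)
Lemma climb_le s : (0 < size s <= H)%N ->
  climb Vhat x (prefix_prob p) subtree_weight s <= 4 * load s * ratioV s.
Proof.
case/andP=> s0 sH; have e0 : 0 <= edge s.
  by apply: (edge_ge0 (H := H)) => // u; apply: prefix_prob_ge0.
have -> : 4 * load s * ratioV s = 2 * (2 * subtree s) / edge s.
  rewrite edge_ratio // s0 mul1r /load /ratio /ratioV.
  by rewrite invfM invf_div; ring.
rewrite /climb ler_wpM2r ?invr_ge0 // ler_pM2l // /subtree_weight.
lra.
Qed.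

(** A sum of products of nonnegative terms is at most the product of the sums; Markov's inequality
    can then treat the two factors separately. *)
Lemma hitting_le (y : H.-tuple A) : hitting y <=
  4 * (\sum_(1 <= h < H.+1) load (take h y))
    * \sum_(1 <= h < H.+1) ratioV (take h y).
Proof.
rewrite /hitting size_tuple.
have -> : \sum_(j < H) climb Vhat x (prefix_prob p) subtree_weight (take j.+1 y)
  = \sum_(1 <= h < H.+1) climb Vhat x (prefix_prob p) subtree_weight (take h y).
  by rewrite big_add1 big_mkord.
set b := \sum_(1 <= h < H.+1) ratioV _.
rewrite mulr_sumr mulr_suml; apply: ler_sum_nat => h hH.
have /andP[h0 hH'] := hH.
apply: le_trans (climb_le _) _; first by rewrite size_take_tuple.
apply: ler_wpM2l; first by apply: mulr_ge0 => //; apply: load_ge0.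
rewrite /b.
rewrite (bigD1_seq h) ?mem_index_iota ?iota_uniq //= lerDl.
by apply: sumr_ge0 => j _; apply: ratioV_take_ge0.
Qed.

Let K := (1 + epsV) / delta.

(** The two sums give a hitting time of at most [64 * H^3 * K^2], so at most [T / 2]. By
    [visits_root] and [subtree_root], [pistar y * ratio y] is then at most [4 * H * (1 + epsV)]
    times the output probability, and the leaf bound [12 * K] yields the constant 48. *)
Lemma out_prob_good (y : H.-tuple A) T :
  128 * (H%:R ^+ 3 * K ^+ 2) <= T%:R ->
  0 < pistar y ->
  \sum_(1 <= h < H.+1) load (take h y) <= 4 * H%:R ^+ 2 * K ->
  \sum_(1 <= h < H.+1) ratioV (take h y) <= 4 * H%:R * K ->
  ratioV y <= 12 * K ->
  0 < out_prob Vhat q (vgb R A H x T) y /\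
  pistar y / out_prob Vhat q (vgb R A H x T) y
  <= 48 * H%:R * (1 + epsV) ^+ 2 / delta.
Proof.
move=> leT y0 le_load le_ratio le_leaf.
have e1 : 0 < 1 + epsV by rewrite ltr_pwDl.
have K0 : 0 < K by rewrite divr_gt0.
have HR : 0 < H%:R :> R by rewrite ltr0n.
have T0 : 0 < T%:R :> R.
  by apply: lt_le_trans leT; rewrite mulr_gt0 // mulr_gt0 // exprn_gt0.
have hitT : hitting y <= T%:R / 2.
  apply: le_trans (hitting_le y) _.
  apply: (@le_trans _ _ (4 * (4 * H%:R ^+ 2 * K) * (4 * H%:R * K))); last first.
    rewrite ler_pdivlMr //; apply: le_trans leT.
    by rewrite le_eqVlt; apply/orP; left; apply/eqP; ring.
  apply: ler_pM => //.
  - by rewrite mulr_ge0 // sumr_ge0 // => h _; apply: load_ge0.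
  - by rewrite sumr_ge0 // => h _; apply: ratioV_take_ge0.
  - by rewrite ler_pM2l.
have yH : take H y = y :> seq A by rewrite -[X in take X](size_tuple y) take_size.
have sy : (size y <= H)%N by rewrite size_tuple.
have [m0 v0] := Vstar_gt0 (leqnn H) y0.
have := V_gt0 (h := H) _ y0 v0; rewrite H_gt0 leqnn => /(_ isT) w0.
rewrite yH in m0 v0 w0.
have r0 : 0 < ratio y by rewrite divr_gt0.
(* A leaf has no edge but the one to its parent. *)
have wE : weight y = Z * (pistar y * ratio y).
  rewrite /weight size_tuple ltnn mul0r addr0 edge_ratio // size_tuple H_gt0 mul1r.
  by rewrite /mass prefix_prob_full tilted_pistar mulrA.
have wy0 : 0 < weight y by rewrite wE mulr_gt0 // mulr_gt0.
have := @visits_root R X A H Vhat q x (prefix_prob p) prefix_next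
  (fun s => prefix_prob_ge0 s p_ge0) q_ge0 V_ge0 subtree_weight
  subtree_weight_ge0 subtree_weightE subtree_weight_eq0 T y _ wy0.
rewrite size_tuple H_gt0 leqnn => /(_ isT).
set v := visits _ _ _ _ _ _ _ => le_v.
have {}le_v : weight y * (T%:R / 2) <= subtree_weight [::] * v.
  apply: le_trans le_v; rewrite ler_pM2l // -[T.+1%:R]natr1; lra.
have lhs0 : 0 < subtree_weight [::] * v.
  by apply: lt_le_trans le_v; rewrite mulr_gt0 // divr_gt0.
have M_ge0 : 0 <= subtree_weight [::] by apply: subtree_weight_ge0.
have M_gt0 : 0 < subtree_weight [::].
  by rewrite lt0r M_ge0 andbT; apply: contraTneq lhs0 => ->; rewrite mul0r ltxx.
have v_gt0 : 0 < v by rewrite -(pmulr_rgt0 _ M_gt0).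
rewrite out_prob_vgb -/v.
have o0 : 0 < v / T%:R by rewrite divr_gt0.
split=> //; rewrite ler_pdivrMr //.
have : pistar y * ratio y <= 4 * H%:R * (1 + epsV) * (v / T%:R).
  rewrite mulrA ler_pdivlMr // -(ler_pM2l Z_gt0).
  have := ler_wpM2r (ltW v_gt0) subtree_root.
  move: le_v; rewrite wE; lra.
rewrite -ler_pdivlMr // => /le_trans; apply.
rewrite -/(ratio y) invf_div -/(ratioV y).
have -> : 48 * H%:R * (1 + epsV) ^+ 2 / delta * (v / T%:R)
  = 4 * H%:R * (1 + epsV) * (v / T%:R) * (12 * K) by rewrite /K; ring.
by rewrite ler_pM2l // mulr_gt0 // mulr_gt0 // mulr_gt0.
Qed.

Lemma sum_pistar : \sum_y pistar y = 1.
Proof. by rewrite -mulr_suml divff // gt_eqF. Qed.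

(** The three Markov bounds are [delta / 4], [delta / 4] and [delta / 12], with sum below
    [delta]. *)
Lemma out_prob_bad T : 128 * (H%:R ^+ 3 * K ^+ 2) <= T%:R ->
  prob_of pistar (fun y =>
    ((48 * H%:R * (1 + epsV) ^+ 2 / delta)%:E
       < (pistar y)%:E / (out_prob Vhat q (vgb R A H x T) y)%:E)%E)
  <= delta.
Proof.
move=> leT.
have e1 : 0 < 1 + epsV by rewrite ltr_pwDl.
have K0 : 0 < K by rewrite divr_gt0.
have HR : 0 < H%:R :> R by rewrite ltr0n.
pose a (y : H.-tuple A) := \sum_(1 <= h < H.+1) load (take h y).
pose b (y : H.-tuple A) := \sum_(1 <= h < H.+1) ratioV (take h y).
apply: le_trans (prob_of_union3 (E1 := fun y => 4 * H%:R ^+ 2 * K < a y)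
  (E2 := fun y => 4 * H%:R * K < b y)
  (E3 := fun y => 12 * K < ratioV (take H y)) pistar_ge0 _) _.
  move=> y y0; apply: contraTT; rewrite !negb_or -!leNgt => /and3P[ay by_ cy].
  have yH : take H y = y :> seq A by rewrite -[X in take X](size_tuple y) take_size.
  rewrite yH in cy.
  have [v_gt0 v_le] := out_prob_good leT y0 ay by_ cy.
  (* Positivity of the output probability keeps the extended quotient finite. *)
  by rewrite inver gt_eqF // -EFinM lee_fin.
have Ba := @markov_prob_of _ _ pistar a _ (4 * H%:R ^+ 2 * K) pistar_ge0 _ _
  (mean_level_sum mean_load).
have Bb := @markov_prob_of _ _ pistar b _ (4 * H%:R * K) pistar_ge0 _ _
  (mean_level_sum mean_ratioV).
have Bc := @markov_prob_of _ _ pistar (fun y => ratioV (take H y)) _ (12 * K)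
  pistar_ge0 _ _ (mean_ratioV (h := H) _).
apply: le_trans (lerD (lerD (Ba _ _) (Bb _ _)) (Bc _ _ _)) _.
- by move=> y; apply: sumr_ge0 => h _; apply: load_ge0.
- by rewrite mulr_gt0 // mulr_gt0 // exprn_gt0.
- by move=> y; apply: sumr_ge0 => h _; apply: ratioV_take_ge0.
- by rewrite mulr_gt0 // mulr_gt0.
- by move=> y; apply: ratioV_take_ge0.
- by rewrite mulr_gt0.
- by rewrite H_gt0 leqnn.
have -> : H%:R * (H%:R * (1 + epsV)) / (4 * H%:R ^+ 2 * K) = delta / 4.
  by rewrite /K; field; rewrite !gt_eqF.
have -> : H%:R * (1 + epsV) / (4 * H%:R * K) = delta / 4.
  by rewrite /K; field; rewrite !gt_eqF.
have -> : (1 + epsV) / (12 * K) = delta / 12.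
  by rewrite /K; field; rewrite !gt_eqF.
have := delta_gt0; lra.
Qed.

End Alignment.

(** * Assembly with explicit constants *)

Theorem theorem4p2 (R : realType) :
  exists (C : R) (k K : nat), 0 < C /\
  forall (A : finType) (H : nat) (X : Type)
    (piref : X -> H.-tuple A -> R) (tau : X -> H.-tuple A -> R)
    (Vhat : X -> seq A -> R) (epsV delta : R) (x : X),
  (1 <= H)%N ->
  (forall x', is_distr (piref x')) ->
  (forall x' y, 0 <= tau x' y) ->
  (forall x', 0 < normalizer (piref x') (tau x')) ->
  (forall x' (s : seq A), (size s <= H)%N -> 0 <= Vhat x' s) ->
  0 <= epsV -> 0 < delta ->
  let Vstar := cond_expect (piref x) (tau x) in
  let pistar := tilt (piref x) (tau x) in
  (* the ratio of Vhat to Vstar is defined *)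
  (forall s : seq A, (1 <= size s <= H)%N -> 0 < prefix_prob (piref x) s ->
     Vstar s = 0 -> Vhat x s = 0) ->
  (forall h, (1 <= h <= H)%N ->
     (expect pistar (fun y =>
        (Vhat x (take h y))%:E / (Vstar (take h y))%:E)
      <= (1 + epsV)%:E)%E) ->
  (forall h, (1 <= h <= H)%N ->
     (expect pistar (fun y =>
        (Vstar (take h y))%:E / (Vhat x (take h y))%:E)
      <= (1 + epsV)%:E)%E) ->
  let T := softO C k (H%:R ^+ 5 * (1 + epsV) ^+ 6 * delta ^- 4) in
  let q := fun x' => next_prob (piref x') in
  let alg : prog R X A (seq A) := vgb R A H x T in
  let pihat := out_prob Vhat q alg in
  (runtime Vhat q alg <= K * (T * #|A|))%N /\
  prob_of pistar (fun y =>
    ((48 * H%:R * (1 + epsV) ^+ 2 / delta)%:E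
       < (pistar y)%:E / (pihat y)%:E)%E)
  <= delta.
Proof.
(* 128 is the constant of [out_prob_bad], the power 0 means no logarithm, and 3 comes from
   [2 * #|A| + 1 <= 3 * #|A|], valid since a distribution on [H]-tuples with [H] positive forces [A]
   to be nonempty. *)
exists 128, 0%N, 3%N; split=> // A H X piref tau Vhat epsV delta x H0 pi_distr
  tau0 Z0 V0 eps0 delta0 Vstar pistar supp mean1 mean2 T q alg pihat.
have p0 : forall y, 0 <= piref x y by have [] := pi_distr x.
have pistar0 y : 0 <= pistar y by apply: pistar_ge0.
have Vstar0 s : 0 <= Vstar s by apply: Vstar_ge0.
have take_size h (y : H.-tuple A) : (size (take h y) <= H)%N.
  by rewrite size_take size_tuple; case: ifP => // /ltnW.
split.
  apply: leq_trans (runtime_vgb _ _ _ _ _) _; rewrite mulnCA leq_mul2l.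
  suff A0 : (0 < #|A|)%N by apply/orP; right; lia.
  have [_ sum1] := pi_distr x.
  case: (pickP (fun _ : H.-tuple A => true)) => [y _|none].
    by apply/card_gt0P; exists (tnth y (Ordinal H0)).
  by move: sum1; rewrite big_pred0 // => /esym/eqP; rewrite oner_eq0.
(* For [delta] at least 1 the bound is trivial. The other case allows [delta ^- 2] to be replaced by
   [delta ^- 4] at the end. *)
case: (lerP 1 delta) => [delta1|delta1].
  apply: le_trans delta1; rewrite -(@sum_pistar _ _ _ (piref x) (tau x)) //.
  by rewrite /prob_of big_mkcond; apply: ler_sum => y _; case: ifP.
apply: out_prob_bad => //.
- exact: V0.
- by move=> h hH; have [] := expect_div_le pistar0 (fun y => V0 x _ (take_size h y))
    (fun y => Vstar0 (take h y)) (mean1 h hH).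
- by move=> h hH; have [] := expect_div_le pistar0 (fun y => Vstar0 (take h y))
    (fun y => V0 x _ (take_size h y)) (mean2 h hH).
- move=> h y hH; have [_ ] := expect_div_le pistar0 (fun y => Vstar0 (take h y))
    (fun y => V0 x _ (take_size h y)) (mean2 h hH); exact.
have f0 : 0 <= H%:R ^+ 5 * (1 + epsV) ^+ 6 * delta ^- 4.
  by rewrite !mulr_ge0 ?invr_ge0 ?exprn_ge0 ?addr_ge0 ?(ltW delta0).
apply: (@le_trans _ _ (128 * (H%:R ^+ 5 * (1 + epsV) ^+ 6 * delta ^- 4))); last first.
  rewrite /T /softO expr0 mulr1 natr_absz ger0_norm ?ceil_ge //.
  by rewrite ceil_ge0; apply: lt_le_trans (mulr_ge0 _ f0); rewrite ?ltrN10.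
rewrite ler_pM2l // expr_div_n mulrA.
apply: ler_pM; rewrite ?mulr_ge0 ?invr_ge0 ?exprn_ge0 ?addr_ge0 ?(ltW delta0) //.
  apply: ler_pM; rewrite ?exprn_ge0 ?addr_ge0 //.
    by apply: ler_weXn2l; rewrite ?ler1n.
  by apply: ler_weXn2l; rewrite ?lerDl.
rewrite lef_pV2 ?posrE ?exprn_gt0 //.
by apply: ler_wiXn2l; rewrite ?ltW.
Qed.
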